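(* Let $\Omega_1,\Omega_2\subseteq\mathbb{R}^n$ be open sets and let $(\gamma_k)_{k=0}^\infty$ be a Riesz basis of $L^2(\Omega_1)$. Let $h:\Omega_2\to\Omega_1$ be a non-singular measurable mapping that induces a composition operator $C_h$ from $L^2(\Omega_1)$ into $L^2(\Omega_2)$, i.e., such that $g_h$ is bounded $\mu$-a.e. on $\Omega_1$. Then the sequence $(C_h\gamma_k)_{k=0}^\infty$ is a Riesz basis of $L^2(\Omega_2)$ if and only if $h$ is injective (in the a.e. sense defined in the context) and there exists $r>0$ such that $g_h\geq r$ $\mu$-a.e. on $\Omega_1$.
   Context: $\Omega_1,\Omega_2$ are equipped with their Borel $\sigma$-algebras $\mathcal{B}(\Omega_1),\mathcal{B}(\Omega_2)$ and Lebesgue measure $\mu$. All functions are real-valued. A measurable mapping $h:\Omega_2\to\Omega_1$ is non-singular if $\mu(B)=0$ implies $\mu(h^{-1}(B))=0$ for every $B\in\mathcal{B}(\Omega_1)$. It induces the linear map $C_hf:=f\circ h$ from $L^2(\Omega_1)$ to the space $L(\Omega_2)$ of measurable functions on $\Omega_2$. If $C_h$ acts boundedly from $L^2(\Omega_1)$ to $L^2(\Omega_2)$, it is called a composition operator from $L^2(\Omega_1)$ into $L^2(\Omega_2)$. The push-forward measure on $\Omega_1$ is $h_\#\mu(B):=\mu(h^{-1}(B))$, $B\in\mathcal{B}(\Omega_1)$. By non-singularity, $h_\#\mu\ll\mu$, and $g_h$ denotes the Radon-Nikodym derivative of $h_\#\mu$ with respect to $\mu$. It is known that a non-singular $h$ induces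 a composition operator from $L^2(\Omega_1)$ into $L^2(\Omega_2)$ if and only if $g_h$ is (essentially) bounded $\mu$-a.e. on $\Omega_1$. The mapping $h$ is called injective if there exists a measurable $h_1:\Omega_1\to\Omega_2$ such that $h_1\circ h$ coincides with the identity on $\Omega_2$ up to a set of $\mu$-measure zero. A Riesz basis of $L^2(\Omega)$ is a sequence of the form $(Ue_k)_{k=0}^\infty$, where $(e_k)_{k=0}^\infty$ is an orthonormal basis of a Hilbert space $L^2(\Omega')$ ($\Omega'\subseteq\mathbb{R}^n$ open) and $U:L^2(\Omega')\to L^2(\Omega)$ is a bounded bijective linear operator. *)

(* Defs.v *)
From HB Require Import structures.
From mathcomp Require Import all_boot all_order all_algebra.
From mathcomp Require Import all_classical all_reals all_analysis.
From mathcomp Require Import measurable_realfun.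

Set Implicit Arguments.
Unset Strict Implicit.
Unset Printing Implicit Defensive.

Import Order.TTheory GRing.Theory Num.Theory.
Import numFieldNormedType.Exports.

Local Open Scope classical_set_scope.
Local Open Scope ring_scope.

(* The Borel sigma-algebra of the topology of the space of matrices, in
   particular of R^n, represented by 'rV[R]_n. *)
HB.instance Definition _ (R : realType) (m n : nat) :=
  @isMeasurable.Build (sigma_display (@open 'M[R]_(m, n))) 'M[R]_(m, n)
    <<s @open 'M[R]_(m, n) >> (@sigma_algebra0 _ setT _)
    (@sigma_algebraC _ _) (@sigma_algebra_bigcup _ setT _).

Section borel_matrix.
Context {R : realType}.

Lemma open_measurable_mx m n (A : set 'M[R]_(m, n)) : open A -> measurable A.
Proof. exact: sub_sigma_algebra. Qed.

Let qball m n (A : set 'M[R]_(m, n)) (p : 'M[rat]_(m, n) * nat) :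
    set 'M[R]_(m, n) :=
  let B := ball (map_mx ratr p.1 : 'M[R]_(m, n)) p.2.+1%:R^-1 in
  if `[< B `<=` A >] then B else set0.

Let open_qball m n (A : set 'M[R]_(m, n)) : open A -> A = \bigcup_p qball A p.
Proof.
move=> oA; rewrite eqEsubset; split => [x Ax|x [p _]]; last first.
  by rewrite /qball; case: ifPn => // /asboolP; apply.
have /nbhs_ballP[e /= e0 eA] : nbhs x A by exact: open_nbhs_nbhs.
have [k ke] : exists k : nat, k.+1%:R^-1 < e / 2.
  have e20 : 0 < e / 2 by rewrite divr_gt0.
  by have [k _ /(_ _ (leqnn k))] := near_infty_natSinv_lt (PosNum e20); exists k.
have k0 : (0 : R) < k.+1%:R^-1 by rewrite invr_gt0.
have q_ij i j : {q : rat | ball (x i j) k.+1%:R^-1 (ratr q : R)}.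
  apply/cid; have [|q] := @rat_in_itvoo R (x i j - k.+1%:R^-1) (x i j + k.+1%:R^-1).
    by rewrite ltrBlDr -addrA ltrDl addr_gt0.
  rewrite in_itv/= => /andP[q1 q2]; exists q.
  by rewrite /ball/= distrC ltr_distl q1 q2.
pose q := \matrix_(i, j) sval (q_ij i j).
have xq : ball x k.+1%:R^-1 (map_mx ratr q : 'M[R]_(m, n)).
  by split => // i j; rewrite !mxE; exact: svalP (q_ij i j).
exists (q, k) => //; rewrite /qball/=.
case: ifPn => [_|/asboolP]; first exact: ball_sym.
case => y qy; apply: eA; rewrite (splitr e).
by apply: ball_triangle; [exact: le_ball (ltW ke) _ xq|exact: le_ball (ltW ke) _ qy].
Qed.

Lemma measurable_fun_mx d (T : measurableType d) m n (f : T -> 'M[R]_(m, n)) :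
  (forall i j, measurable_fun setT (fun x => f x i j)) -> measurable_fun setT f.
Proof.
move=> mf; apply: (@measurability _ _ _ _ _ _ (@open 'M[R]_(m, n))) => //.
move=> _ [A /open_qball -> <-]; rewrite setTI preimage_bigcup.
apply: countable_bigcupT_measurable => [|p]; first exact/countableP.
rewrite /qball; case: ifPn => // _; last by rewrite preimage_set0.
rewrite (_ : _ @^-1` _ = \bigcap_(ij in [set: 'I_m * 'I_n])
    ((fun x => f x ij.1 ij.2) @^-1`
      ball (ratr (p.1 ij.1 ij.2) : R) p.2.+1%:R^-1)).
  apply: fin_bigcap_measurable; first exact: finite_finset.
  move=> [i j] _ /=; rewrite -[X in measurable X]setTI; apply: mf => //.
  by apply: open_measurable; exact: ball_open.
rewrite eqEsubset; split => x /=.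
  by move=> [_ B] [i j] _ /=; have := B i j; rewrite mxE.
move=> B; split => [|i j]; first by rewrite invr_gt0.
by rewrite mxE; exact: B (i, j) I.
Qed.

Lemma continuous_measurable_mx m n (f : 'M[R]_(m, n) -> R) :
  continuous f -> measurable_fun setT f.
Proof.
move=> /continuousP cf; apply: (measurability _ (RGenOpens.measurableE R)).
move=> _ [_ [a [b ->] <-]]; rewrite setTI; apply: open_measurable_mx.
exact/cf/interval_open.
Qed.

Lemma measurable_coord m n (i : 'I_m) (j : 'I_n) :
  measurable_fun setT (fun M : 'M[R]_(m, n) => M i j).
Proof. by apply: continuous_measurable_mx; exact: coord_continuous. Qed.

End borel_matrix.

Section lebesgue_row.
Context {R : realType}.

Definition row_cons n (p : measurableTypeR R * 'rV[R]_n) : 'rV[R]_n.+1 :=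
  \row_i (if unlift ord0 i is Some j then p.2 ord0 j else p.1).

Definition row_uncons n (v : 'rV[R]_n.+1) : measurableTypeR R * 'rV[R]_n :=
  (v ord0 ord0, \row_i v ord0 (lift ord0 i)).

Lemma row_consK n : cancel (@row_cons n) (@row_uncons n).
Proof.
case=> x v; rewrite /row_uncons mxE unlift_none; congr pair.
by apply/rowP => i; rewrite !mxE liftK.
Qed.

Lemma row_unconsK n : cancel (@row_uncons n) (@row_cons n).
Proof.
move=> v; apply/rowP => i; rewrite mxE.
by case: unliftP => [j|] ->; rewrite /= ?mxE.
Qed.

Lemma measurable_row_cons n : measurable_fun setT (@row_cons n).
Proof.
apply: measurable_fun_mx => i j; rewrite ord1.
under eq_fun do rewrite mxE.
case: unliftP => [k|] _; last exact: measurable_fst.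
exact: measurableT_comp (measurable_coord _ _) measurable_snd.
Qed.

Lemma measurable_row_uncons n : measurable_fun setT (@row_uncons n).
Proof.
apply: measurable_fun_pair; first exact: measurable_coord.
apply: measurable_fun_mx => i j.
under eq_fun do rewrite mxE.
exact: measurable_coord.
Qed.

Section lebesgue_cons.
Variables (n : nat) (mu : {sigma_finite_measure set 'rV[R]_n -> \bar R}).
Local Open Scope ereal_scope.

Definition lebesgue_cons : set 'rV[R]_n.+1 -> \bar R :=
  pushforward (@lebesgue_measure R \x mu) (@row_cons n).

Let mcons (A : set 'rV[R]_n.+1) :
  measurable A -> measurable (@row_cons n @^-1` A).
Proof. by move=> mA; rewrite -[X in measurable X]setTI; exact: measurable_row_cons. Qed.

Let lebesgue_cons0 : lebesgue_cons set0 = 0.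
Proof. by rewrite /lebesgue_cons /pushforward preimage_set0 measure0. Qed.

Let lebesgue_cons_ge0 A : 0 <= lebesgue_cons A.
Proof. by rewrite /lebesgue_cons /pushforward; exact: measure_ge0. Qed.

Let lebesgue_cons_sigma_additive : semi_sigma_additive lebesgue_cons.
Proof.
move=> F mF tF mUF; rewrite /lebesgue_cons /pushforward preimage_bigcup.
apply: measure_semi_sigma_additive.
- by move=> k; exact: mcons.
- apply/trivIsetP => /= i j _ _ ij; rewrite -preimage_setI.
  by move/trivIsetP : tF => /(_ _ _ _ _ ij) ->//; rewrite preimage_set0.
- by rewrite -preimage_bigcup; exact: mcons.
Qed.

HB.instance Definition _ := isMeasure.Build _ _ _ lebesgue_cons
  lebesgue_cons0 lebesgue_cons_ge0 lebesgue_cons_sigma_additive.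

Let lebesgue_cons_sigma_finite : sigma_finite setT lebesgue_cons.
Proof.
have /sigma_finiteP[F [TF ndF Foo]] := sigma_finiteT (@lebesgue_measure R).
have /sigma_finiteP[G [TG ndG Goo]] := sigma_finiteT mu.
exists (fun k => @row_uncons n @^-1` (F k `*` G k)).
  rewrite -preimage_bigcup; apply/esym; rewrite -subTset => v _ /=.
  have [i _ Fi] : (\bigcup_k F k) (row_uncons v).1 by rewrite -TF.
  have [j _ Gj] : (\bigcup_k G k) (row_uncons v).2 by rewrite -TG.
  exists (maxn i j) => //; split.
    by move: Fi; exact/subsetPset/ndF/leq_maxl.
  by move: Gj; exact/subsetPset/ndG/leq_maxr.
move=> k; have [mFk Fkoo] := Foo k; have [mGk Gkoo] := Goo k; split.
  rewrite -[X in measurable X]setTI; apply: measurable_row_uncons => //.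
  exact: measurableX.
rewrite /lebesgue_cons /pushforward -comp_preimage.
rewrite (_ : _ \o _ = id); last by apply/funext => p /=; rewrite row_consK.
by rewrite preimage_id product_measure1E// lte_mul_pinfty// ge0_fin_numE.
Qed.

HB.instance Definition _ := Measure_isSigmaFinite.Build _ _ _ lebesgue_cons
  lebesgue_cons_sigma_finite.

End lebesgue_cons.

(* Lebesgue measure on (the Borel sets of) R^n, as an n-fold product;
   lebesgue_rV_box computes it on boxes. *)
Fixpoint lebesgue_rV (n : nat) : {sigma_finite_measure set 'rV[R]_n -> \bar R} :=
  if n is n'.+1 then lebesgue_cons (lebesgue_rV n') else dirac (0 : 'rV[R]_0).

Lemma lebesgue_rV_box n (a b : 'rV[R]_n) : (forall i, a ord0 i <= b ord0 i) ->
  lebesgue_rV n [set x | forall i, x ord0 i \in `[a ord0 i, b ord0 i]] =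
  (\prod_i (b ord0 i - a ord0 i))%:E.
Proof.
elim: n a b => [|n IH] a b ab /=.
  by rewrite big_ord0 diracE mem_set// => -[].
rewrite /lebesgue_cons /pushforward.
rewrite (_ : _ @^-1` _ = [set` `[a ord0 ord0, b ord0 ord0]] `*`
  [set x : 'rV[R]_n | forall i, x ord0 i \in
    `[(row_uncons a).2 ord0 i, (row_uncons b).2 ord0 i]]); last first.
  apply/seteqP; split => -[x v] /=.
    move=> xv; split => [|i /=]; first by have := xv ord0; rewrite mxE unlift_none.
    by have := xv (lift ord0 i); rewrite !mxE liftK.
  move=> [xab vab] i; rewrite /row_cons mxE.
  by case: unliftP => [j|] -> //=; have := vab j; rewrite /= !mxE.
have ab' i : (row_uncons a).2 ord0 i <= (row_uncons b).2 ord0 i by rewrite !mxE.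
rewrite product_measure1E//; last first.
  rewrite (_ : [set x | _] = \bigcap_(i in [set: 'I_n]) ((fun x : 'rV[R]_n => x ord0 i) @^-1` [set` `[(row_uncons a).2 ord0 i, (row_uncons b).2 ord0 i]])).
    apply: fin_bigcap_measurable; first exact: finite_finset.
    by move=> i _; rewrite -[X in measurable X]setTI; apply: measurable_coord.
  by apply/seteqP; split => x /= xab i; have := xab i; [move=> + _|apply].
rewrite IH// [X in (X * _)%E]lebesgue_measure_itv/= lte_fin big_ord_recl EFinM.
congr (_ * _)%E; last by congr EFin; apply: eq_bigr => i _; rewrite !mxE.
case: ltgtP (ab ord0) => // -> _; by rewrite subrr.
Qed.

End lebesgue_row.

Local Open Scope quotient_scope.

Notation L2 mu := (LspaceType2 mu).

Section L2_space.
Context d (T : measurableType d) (R : realType).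
Variable mu : {measure set T -> \bar R}.

Local Notation L0 := {mfun_ mu, T >-> measurableTypeR R}.

Definition L0_class (f : T -> R) (mf : measurable_fun setT f) : L0 :=
  \pi_(L0) (@mfun_Sub _ _ T (measurableTypeR R) f (mem_set mf)).

Lemma L0_classE (f : T -> R) (mf : measurable_fun setT f) :
  L0_class mf = f %[ae mu].
Proof.
rewrite /L0_class; set g := mfun_Sub _.
have /eqmodP/asboolP : \pi_(L0) (repr (\pi_(L0) g)) = \pi_(L0) g by rewrite reprK.
exact.
Qed.

Lemma L0P (f g : L0) : f = g %[ae mu] -> f = g.
Proof.
by move=> fg; rewrite -[f]reprK -[g]reprK; apply/eqmodP/asboolP.
Qed.

Lemma measurable_L0 (f : L0) : measurable_fun setT (f : T -> R).
Proof. exact: (measurable_funPT (repr f)). Qed.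

Let finite_norm_ae (f g : T -> R) :
  measurable_fun setT f -> measurable_fun setT g -> f = g %[ae mu] ->
  finite_norm mu 2%:E f -> finite_norm mu 2%:E g.
Proof.
move=> mf mg fg; rewrite /finite_norm unlock.
have m2 (h : T -> R) : measurable_fun setT h ->
    measurable_fun setT (fun x => `|(EFin \o h) x| `^ 2)%E.
  move=> mh; apply/measurable_EFinP.
  apply: (@measurableT_comp _ _ _ _ _ _ (@powR R ^~ 2)) => //.
  exact: measurableT_comp.
rewrite (@ge0_ae_eq_integral _ _ _ mu setT _ (fun x => `|(EFin \o g) x| `^ 2)%E)//.
- exact: m2.
- exact: m2.
- by move=> x _; exact: poweR_ge0.
- by move=> x _; exact: poweR_ge0.
- by apply: filterS fg => x /= /(_ I) ->.
Qed.

Definition L2_class (f : T -> R) (Lf : f \in Lfun mu 2%:E) : L2 mu :=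
  let mf := set_mem (sub_Lfun_mfun Lf) in
  LebesgueSpace.Pack (LebesgueSpace.Class (isFinLebesgue.Build _ _ _ mu _ (lee1n 2)
    (L0_class mf) (finite_norm_ae mf (measurable_L0 (L0_class mf))
       (ae_eq_sym (L0_classE mf)) (set_mem (sub_Lfun_finLfun Lf))))).

Lemma L2_classE (f : T -> R) (Lf : f \in Lfun mu 2%:E) : L2_class Lf = f %[ae mu].
Proof. exact: L0_classE. Qed.

Lemma L2P (f g : L2 mu) : f = g %[ae mu] -> f = g.
Proof.
case: f g => [f [[fP]]] [g [[gP]]] /= /L0P fg; rewrite -{}fg in gP *.
by rewrite (Prop_irrelevance fP gP).
Qed.

Lemma L2_Lfun (f : L2 mu) : (f : T -> R) \in Lfun mu 2%:E.
Proof.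
by rewrite inE; apply/andP; split; rewrite inE; [exact: measurable_L0|
  exact: Lebesgue_finite].
Qed.

HB.instance Definition _ := gen_eqMixin (L2 mu).
HB.instance Definition _ := gen_choiceMixin (L2 mu).

Let Lfun0 : cst 0 \in Lfun mu 2%:E.
Proof. by have [] := Lfun_addr_closed mu (lee1n 2). Qed.
Let LfunD (f g : L2 mu) : (f : T -> R) \+ g \in Lfun mu 2%:E.
Proof. by have [_] := Lfun_addr_closed mu (lee1n 2); apply; exact: L2_Lfun. Qed.
Let LfunN (f : L2 mu) : \- (f : T -> R) \in Lfun mu 2%:E.
Proof. by apply: (@Lfun_oppr_closed _ _ _ mu); exact: L2_Lfun. Qed.
Let LfunZ a (f : L2 mu) : a \*: (f : T -> R) \in Lfun mu 2%:E.
Proof.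
have [_ /(_ a _ _ (L2_Lfun f) Lfun0)] := Lfun_submod_closed mu (lee1n 2).
by rewrite (_ : _ + _ = a \*: (f : T -> R))//; apply/funext => x; exact: addr0.
Qed.

Definition L2_zero := L2_class Lfun0.
Definition L2_add f g := L2_class (LfunD f g).
Definition L2_opp f := L2_class (LfunN f).
Definition L2_scale a f := L2_class (LfunZ a f).

Let addE f g : L2_add f g = (f : T -> R) \+ g %[ae mu].
Proof. exact: L2_classE. Qed.

Let L2_addA : associative L2_add.
Proof.
move=> f g h; apply: L2P.
have := addE f g; apply: filter_app.
have := addE (L2_add f g) h; apply: filter_app.
have := addE g h; apply: filter_app.
have := addE f (L2_add g h); apply: filter_app.
apply: aeW.
by move=> x /= /(_ I)-> /(_ I)-> /(_ I)-> /(_ I)-> _; rewrite addrA.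
Qed.

Let L2_addC : commutative L2_add.
Proof.
move=> f g; apply: L2P.
have := addE g f; apply: filter_app.
have := addE f g; apply: filter_app.
apply: aeW.
by move=> x /= /(_ I)-> /(_ I)-> _; rewrite addrC.
Qed.

Let L2_add0 : left_id L2_zero L2_add.
Proof.
move=> f; apply: L2P.
have := L2_classE Lfun0; apply: filter_app.
have := addE L2_zero f; apply: filter_app.
apply: aeW.
by move=> x /= /(_ I)-> /(_ I)-> _; rewrite add0r.
Qed.

Let L2_addN : left_inverse L2_zero L2_opp L2_add.
Proof.
move=> f; apply: L2P.
have := L2_classE Lfun0; apply: filter_app.
have := L2_classE (LfunN f); apply: filter_app.
have := addE (L2_opp f) f; apply: filter_app.
apply: aeW.
by move=> x /= /(_ I)-> /(_ I)-> /(_ I)-> _; rewrite addNr.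
Qed.

HB.instance Definition _ :=
  GRing.isZmodule.Build (L2 mu) L2_addA L2_addC L2_add0 L2_addN.

Let scaleE a f : L2_scale a f = a \*: (f : T -> R) %[ae mu].
Proof. exact: L2_classE. Qed.

Let L2_scaleA a b f : L2_scale a (L2_scale b f) = L2_scale (a * b) f.
Proof.
apply: L2P.
have := scaleE (a * b) f; apply: filter_app.
have := scaleE b f; apply: filter_app.
have := scaleE a (L2_scale b f); apply: filter_app.
apply: aeW.
by move=> x /= /(_ I)-> /(_ I)-> /(_ I)-> _; exact: mulrA.
Qed.

Let L2_scale1 : left_id 1 L2_scale.
Proof.
move=> f; apply: L2P.
have := scaleE 1 f; apply: filter_app.
apply: aeW.
by move=> x /= /(_ I)-> _; exact: mul1r.
Qed.

Let L2_scaleDr : right_distributive L2_scale +%R.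
Proof.
move=> a f g; apply: L2P.
have := scaleE a g; apply: filter_app.
have := scaleE a f; apply: filter_app.
have := addE (L2_scale a f) (L2_scale a g); apply: filter_app.
have := addE f g; apply: filter_app.
have := scaleE a (f + g); apply: filter_app.
apply: aeW.
move=> x /= /(_ I)-> /(_ I)-> /(_ I)-> /(_ I)-> /(_ I)-> _; exact: mulrDr.
Qed.

Let L2_scaleDl f : {morph L2_scale^~ f : a b / a + b}.
Proof.
move=> a b; apply: L2P.
have := scaleE b f; apply: filter_app.
have := scaleE a f; apply: filter_app.
have := addE (L2_scale a f) (L2_scale b f); apply: filter_app.
have := scaleE (a + b) f; apply: filter_app.
apply: aeW.
move=> x /= /(_ I)-> /(_ I)-> /(_ I)-> /(_ I)-> _; exact: mulrDl.
Qed.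

HB.instance Definition _ := GRing.Zmodule_isLmodule.Build R (L2 mu)
  L2_scaleA L2_scale1 L2_scaleDr L2_scaleDl.

Lemma L2_addE (f g : L2 mu) : f + g = (f : T -> R) \+ g %[ae mu].
Proof. exact: addE. Qed.

Lemma L2_scaleE (a : R) (f : L2 mu) : a *: f = a \*: (f : T -> R) %[ae mu].
Proof. exact: scaleE. Qed.

Definition L0_of_L2 (f : L2 mu) : L0 := f.

Definition L2_norm (f : L2 mu) : R := fine ('N[mu]_2%:E [EFin \o f])%E.
Definition L2_dot (f g : L2 mu) : R := \int[mu]_x (f x * g x).

End L2_space.

Section riesz_basis.
Context {R : realType} (n : nat).
Local Notation mu := (lebesgue_rV n : set 'rV[R]_n -> \bar R).
Local Notation L0 nu := {mfun_ nu, 'rV[R]_n >-> measurableTypeR R}.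

(* L^2(Omega) is represented as L2 (lebesgue_on oO): classes of Borel functions
   on R^n modulo equality almost everywhere on Omega. Restriction to Omega
   identifies it with the classes of Borel functions on Omega. The subtype of
   Omega is not used because a measurableType must be inhabited, whereas Omega
   may be empty. *)
Definition lebesgue_on (Omega : set 'rV[R]_n) (oO : open Omega) :
    {measure set 'rV[R]_n -> \bar R} :=
  mrestr mu (open_measurable_mx oO).

Definition orthonormal_basis d (T : measurableType d)
    (nu : {measure set T -> \bar R}) (e : nat -> L2 nu) :=
  (forall i j, L2_dot (e i) (e j) = (i == j)%:R) /\
  forall f, L2_norm (f - \sum_(i < N) L2_dot f (e i) *: e i) @[N --> \oo] --> 0.

Definition bounded_op d d' (T : measurableType d) (T' : measurableType d')
    (nu : {measure set T -> \bar R}) (nu' : {measure set T' -> \bar R})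
    (U : L2 nu -> L2 nu') :=
  exists C : R, forall f, L2_norm (U f) <= C * L2_norm f.

(* The members of the sequence are classes of measurable functions, not assumed
   a priori to be square-integrable. *)
Definition riesz_basis (Omega : set 'rV[R]_n) (oO : open Omega)
    (g : nat -> L0 (lebesgue_on oO)) :=
  exists (Omega' : set 'rV[R]_n) (oO' : open Omega')
    (e : nat -> L2 (lebesgue_on oO'))
    (U : {linear L2 (lebesgue_on oO') -> L2 (lebesgue_on oO)}),
    [/\ orthonormal_basis e, bounded_op U, bijective U &
        forall k, g k = L0_of_L2 (U (e k))].

Section composition.
Variables (Omega1 Omega2 : set 'rV[R]_n) (oO1 : open Omega1) (oO2 : open Omega2).
(* A mapping from Omega2 to Omega1 is a function on R^n that sends Omega2 into
   Omega1; its values outside Omega2 play no role. *)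
Variable h : {fun Omega2 >-> Omega1}.

Definition pushforward_on (B : set 'rV[R]_n) : \bar R :=
  mu (Omega2 `&` h @^-1` B).

Definition nonsingular := forall B, measurable B -> B `<=` Omega1 ->
  mu B = 0%E -> pushforward_on B = 0%E.

Definition is_radon_nikodym (g : 'rV[R]_n -> \bar R) :=
  [/\ measurable_fun Omega1 g, (forall x, Omega1 x -> 0 <= g x)%E &
      forall B, measurable B -> B `<=` Omega1 ->
        pushforward_on B = (\int[mu]_(x in B) g x)%E].

Definition ae_injective := exists h1 : {fun Omega1 >-> Omega2},
  measurable_fun Omega1 h1 /\ (\forall x \ae mu, Omega2 x -> h1 (h x) = x).

Hypothesis mh : measurable_fun Omega2 h.

Lemma measurable_comp_on (f : 'rV[R]_n -> R) : measurable_fun setT f ->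
  measurable_fun setT ((f \o h) \_ Omega2).
Proof.
move=> mf; apply/(measurable_restrictT _ (open_measurable_mx oO2)).
exact: measurableT_comp.
Qed.

(* Extension by 0 outside Omega2 only provides a Borel function on R^n: the class
   depends on f \o h on Omega2. By comp_opE it does not depend on the
   representative of f when h is non-singular. *)
Definition comp_op (f : L2 (lebesgue_on oO1)) : L0 (lebesgue_on oO2) :=
  L0_class (lebesgue_on oO2) (measurable_comp_on (measurable_L0 f)).

Lemma comp_opE (f : L2 (lebesgue_on oO1)) (f' : 'rV[R]_n -> R) : nonsingular ->
  f = f' %[ae lebesgue_on oO1] ->
  (comp_op f : 'rV[R]_n -> R) = f' \o h %[ae lebesgue_on oO2].
Proof.
move=> ns [A [mA A0 fA]].
pose A1 := A `&` Omega1.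
have mA1 : measurable A1 by apply: measurableI => //; exact: open_measurable_mx.
have mhA : measurable (Omega2 `&` h @^-1` A1).
  by apply: mh => //; exact: open_measurable_mx.
have hA0 : lebesgue_on oO2 ((Omega2 `&` h @^-1` A1) `|` ~` Omega2) = 0%E.
  rewrite /lebesgue_on/= /mrestr setIUl setICl setU0 setIAC setIid.
  by apply: ns => //; exact: subIsetr.
have := L0_classE (lebesgue_on oO2) (measurable_comp_on (measurable_L0 f)).
apply: filter_app; exists ((Omega2 `&` h @^-1` A1) `|` ~` Omega2); split => //.
  by apply: measurableU => //; apply: measurableC; exact: open_measurable_mx.
move=> x /= fx; apply: contrapT => /not_orP[/not_andP[|]hx Ox].
  by apply: Ox.
apply: fx => /(_ I) fx _; rewrite [LHS]fx patchE mem_set/=; last exact: contrapT Ox.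
apply: contrapT => ff'; apply: hx; split; last first.
  exact: funS (contrapT Ox).
by apply: fA => /= /(_ I).
Qed.

(* C_h is bounded from L^2(Omega1) to L^2(Omega2); the norm on the left is
   extended-real and the bound makes it finite. *)
Definition composition_operator := exists C : R, forall f : L2 (lebesgue_on oO1),
  ('N[lebesgue_on oO2]_2%:E [EFin \o comp_op f]
     <= C%:E * 'N[lebesgue_on oO1]_2%:E [EFin \o f])%E.

End composition.
End riesz_basis.

(* Main.v *)
Require Import Defs.
From HB Require Import structures.
From mathcomp Require Import all_boot all_order all_algebra.
From mathcomp Require Import all_classical all_reals all_analysis.
From mathcomp Require Import measurable_realfun ring lra.

(** Let T be C_h with values in L^2(Omega2), and write gamma_k = U e_k with U
    a bounded bijection and (e_k) an orthonormal basis. The proof shows that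
    each side of the equivalence says that T is bijective.

    If T is bijective, then T o U is a bounded bijection, which sends (e_k) to
    (C_h gamma_k). Conversely suppose that C_h gamma_k = V e'_k with V a bounded
    bijection and (e'_k) an orthonormal basis. By the Riesz-Fischer theorem
    every x in the source of U has a partner x' in the source of V with the same
    coordinates, and every x' has such a partner x; as T U and V agree on the
    basis vectors and are bounded, T U x = V x' for partners. So T U is bijective
    along with V, and T is bijective along with U
    (bijective_same_basis). No inverse operator has to be bounded for this, which
    is why the open mapping theorem does not appear; the analytic input is the
    completeness of L^2 (L2_complete_fast).

    If T is bijective, injectivity says that a set B with a null preimage
    under h is null (comp_injective_null). If g_h had no positive lower bound,
    all the sets F_k = {g_h < 4^-k} would have positive measure, and a suitable
    series of functions carried by the F_k would be the square of a function s
    with s o h square-integrable and s not; but s o h = f o h with f in L^2 by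
    surjectivity, so s = f almost everywhere
    (comp_bijective_lower_bound). Surjectivity also makes every measurable
    function on Omega2 a function of h, as it is a quotient of two
    square-integrable ones (comp_surjective_factor); the coordinates of x,
    written as functions of h x, are those of a left inverse of h.

    If g_h >= r > 0, the Lebesgue measure of B is at most r^-1 times the measure
    of the preimage of B. So h detects null sets, which is the injectivity of T;
    and for a left inverse h1 of h and psi in L^2(Omega2), the function psi o h1
    is square-integrable and T sends it to psi. *)

Set Implicit Arguments.
Unset Strict Implicit.
Unset Printing Implicit Defensive.

Import Order.TTheory GRing.Theory Num.Theory.
Import numFieldNormedType.Exports.

Local Open Scope classical_set_scope.
Local Open Scope ring_scope.

(** * The Hilbert space L2 *)

Lemma L0_of_L2_inj d (T : measurableType d) (R : realType)
    (mu : {measure set T -> \bar R}) : injective (@L0_of_L2 _ T R mu).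
Proof.
move=> f g fg; apply: L2P; move: fg; rewrite /L0_of_L2 => ->.
exact: ae_eq_refl.
Qed.

Section L2_hilbert.
Context d (T : measurableType d) (R : realType) (mu : {measure set T -> \bar R}).
Implicit Types f g h : L2 mu.

Let measurable_L2 f : measurable_fun setT (f : T -> R).
Proof. exact: measurable_L0. Qed.

Lemma integrable_L2M f g :
  mu.-integrable setT (EFin \o (fun x => f x * g x)).
Proof.
by apply/Lfun1_integrable; apply: Lfun2_mul_Lfun1; exact: L2_Lfun.
Qed.

Lemma L2_dotC f g : L2_dot f g = L2_dot g f.
Proof. by rewrite /L2_dot; under eq_Rintegral do rewrite mulrC. Qed.

Lemma L2_dotDl f g h : L2_dot (f + g) h = L2_dot f h + L2_dot g h.
Proof.
rewrite /L2_dot -RintegralD//; try exact: integrable_L2M.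
congr fine; apply: ae_eq_integral => //.
- by apply/measurable_EFinP; apply: measurable_funM.
- apply/measurable_EFinP; apply: measurable_funD; exact: measurable_funM.
- have := L2_addE f g; apply: filterS => x /= /(_ I) -> _.
  by rewrite mulrDl.
Qed.

Lemma L2_dotZl a f g : L2_dot (a *: f) g = a * L2_dot f g.
Proof.
rewrite /L2_dot -RintegralZl//; try exact: integrable_L2M.
congr fine; apply: ae_eq_integral => //.
- by apply/measurable_EFinP; apply: measurable_funM.
- by apply/measurable_EFinP; do 2 apply: measurable_funM => //.
- have := L2_scaleE a f; apply: filterS => x /= /(_ I) -> _.
  by rewrite mulrA.
Qed.

Lemma L2_dot0l f : L2_dot 0 f = 0.
Proof. by rewrite -(scale0r f) L2_dotZl mul0r. Qed.

Lemma L2_dotBl f g h : L2_dot (f - g) h = L2_dot f h - L2_dot g h.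
Proof. by rewrite L2_dotDl -scaleN1r L2_dotZl mulN1r. Qed.

Lemma L2_dot_suml (I : Type) (r : seq I) (P : pred I) (F : I -> L2 mu) g :
  L2_dot (\sum_(i <- r | P i) F i) g = \sum_(i <- r | P i) L2_dot (F i) g.
Proof.
apply: (big_morph (fun f => L2_dot f g)) => [f f'|]; first exact: L2_dotDl.
exact: L2_dot0l.
Qed.

Lemma L2_subE f g : (f - g : L2 mu) = (f : T -> R) \- g %[ae mu].
Proof.
rewrite -scaleN1r.
have := L2_scaleE (-1) g; apply: filter_app.
have := L2_addE f (-1 *: g); apply: filterS.
by move=> x /(_ I) -> /(_ I) E _; congr (_ + _); rewrite [LHS]E; exact: mulN1r.
Qed.

Lemma integral_L2_sqr f : (\int[mu]_x (f x ^+ 2)%:E)%E = (L2_dot f f)%:E.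
Proof.
rewrite /L2_dot /Rintegral fineK.
  by apply: eq_integral => x _; rewrite expr2.
exact: integrable_fin_num (integrable_L2M f f).
Qed.

Lemma L2_norm_ge0 f : 0 <= L2_norm f.
Proof. by rewrite fine_ge0// Lnorm_ge0. Qed.

Lemma L2_normE f : (L2_norm f)%:E = ('N[mu]_2%:E [EFin \o f])%E.
Proof.
rewrite /L2_norm fineK// ge0_fin_numE ?Lnorm_ge0//.
exact: Lebesgue_finite.
Qed.

Lemma L2_norm_sqr f : L2_norm f ^+ 2 = L2_dot f f.
Proof.
apply/EFin_inj; rewrite -integral_L2_sqr.
transitivity (('N[mu]_2%:E [EFin \o f]) `^ 2)%E.
  by rewrite -L2_normE poweR_EFin powR_mulrn ?L2_norm_ge0.
rewrite powR_Lnorm//; apply: eq_integral => x _ /=.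
by rewrite powR_mulrn// real_normK ?num_real.
Qed.

Lemma L2_dot_ge0 f : 0 <= L2_dot f f.
Proof. by rewrite -L2_norm_sqr sqr_ge0. Qed.

Lemma L2_norm_eq0 f : L2_norm f = 0 -> f = 0.
Proof.
move=> f0; apply: L2P.
have : ('N[mu]_2%:E [EFin \o f])%E = 0%E by rewrite -L2_normE f0.
have mf : measurable_fun setT (EFin \o (f : T -> R)) by exact/measurable_EFinP.
move/(Lnorm_eq0_eq0 mf) => /(_ (ltr0n _ 2)); apply: filter_app.
rewrite -(scale0r f).
have := L2_scaleE 0 f; apply: filterS.
move=> x /(_ I) E f0x _; rewrite E.
have fx0 : f x = 0 by apply: EFin_inj; exact: f0x.
by rewrite fx0; exact/esym/mul0r.
Qed.

Lemma L2_dot_eq0 f : L2_dot f f = 0 -> f = 0.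
Proof.
by rewrite -L2_norm_sqr => /eqP; rewrite sqrf_eq0 => /eqP/L2_norm_eq0.
Qed.

(** The parallelogram inequality: the difference of the two sides is the square
    of f - g. It replaces the triangle inequality wherever only convergence to 0
    matters. *)
Lemma L2_sqrD_le f g :
  L2_dot (f + g) (f + g) <= 2 * L2_dot f f + 2 * L2_dot g g.
Proof.
have := L2_dot_ge0 (f - g).
rewrite !(L2_dotBl, L2_dotDl) (L2_dotC f (_ - _)) (L2_dotC f (_ + _)).
rewrite (L2_dotC g (_ - _)) (L2_dotC g (_ + _)).
by rewrite !(L2_dotBl, L2_dotDl) (L2_dotC g f); lra.
Qed.

Section orthonormal_family.
Variable e : nat -> L2 mu.
Hypothesis e_orth : forall i j, L2_dot (e i) (e j) = (i == j)%:R.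

Let partial (a : nat -> R) (n : nat) : L2 mu := \sum_(i < n) a i *: e i.

Lemma L2_dot_partial_basis (a : nat -> R) n k :
  L2_dot (partial a n) (e k) = if (k < n)%N then a k else 0.
Proof.
rewrite L2_dot_suml; case: ifPn => [kn|kn].
  rewrite (bigD1 (Ordinal kn))//= L2_dotZl e_orth eqxx mulr1 big1 ?addr0//.
  by move=> i ik; rewrite L2_dotZl e_orth (negbTE (ik : (i : nat) != k)) mulr0.
rewrite big1// => i _; rewrite L2_dotZl e_orth.
by rewrite ltn_eqF ?mulr0// (leq_trans (ltn_ord i))// leqNgt.
Qed.

Lemma L2_dot_partialr (a : nat -> R) n f :
  L2_dot f (partial a n) = \sum_(i < n) a i * L2_dot f (e i).
Proof.
rewrite L2_dotC L2_dot_suml; apply: eq_bigr => i _.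
by rewrite L2_dotZl L2_dotC.
Qed.

Lemma L2_dot_partial (a : nat -> R) m n : (n <= m)%N ->
  L2_dot (partial a m) (partial a n) = \sum_(i < n) a i ^+ 2.
Proof.
move=> nm; rewrite L2_dot_partialr; apply: eq_bigr => i _.
by rewrite L2_dot_partial_basis (leq_trans (ltn_ord i) nm) expr2.
Qed.

Lemma L2_dot_partialB (a : nat -> R) m n : (n <= m)%N ->
  L2_dot (partial a m - partial a n) (partial a m - partial a n) =
  \sum_(i < m) a i ^+ 2 - \sum_(i < n) a i ^+ 2.
Proof.
move=> nm; rewrite L2_dotBl !(L2_dotC _ (_ - _)) !L2_dotBl.
by rewrite (L2_dotC (partial a n)) !L2_dot_partial//; ring.
Qed.

(** The squared distance from f to its projection on the first n vectors is
    nonnegative and equals the difference of the two sides. *)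
Lemma L2_bessel f n : \sum_(i < n) L2_dot f (e i) ^+ 2 <= L2_dot f f.
Proof.
pose a i := L2_dot f (e i).
have := L2_dot_ge0 (f - partial a n).
rewrite L2_dotBl !(L2_dotC _ (_ - _)) !L2_dotBl (L2_dotC _ f) L2_dot_partial//.
rewrite L2_dot_partialr.
under eq_bigr do rewrite -expr2.
lra.
Qed.

End orthonormal_family.

(** * Completeness of L2 and the Riesz-Fischer theorem *)

Lemma Lfun2P (f : T -> R) : measurable_fun setT f ->
  (\int[mu]_x (f x ^+ 2)%:E < +oo)%E -> f \in Lfun mu 2%:E.
Proof.
move=> mf foo; rewrite inE; apply/andP; split; rewrite inE//=.
rewrite /finite_norm unlock poweR_lty//.
rewrite (eq_integral (fun x => (f x ^+ 2)%:E))// => x _ /=.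
by rewrite powR_mulrn// real_normK ?num_real.
Qed.

(** Along a sequence converging this fast the series of the weighted squares
    4^j (u_{j+1} - u_j)^2 has a finite integral, hence is finite almost
    everywhere; there u_{j+1} - u_j is O(2^-j) and u converges pointwise.
    Fatou's lemma turns pointwise into mean square convergence. *)
Lemma L2_complete_fast (u : nat -> L2 mu) :
  (forall i j, (j <= i)%N -> L2_dot (u i - u j) (u i - u j) <= (8 ^+ j)^-1) ->
  exists f, forall j, L2_dot (f - u j) (f - u j) <= (8 ^+ j)^-1.
Proof.
move=> u_cauchy.
have int_uB i j : (\int[mu]_x ((u i x - u j x) ^+ 2)%:E =
    (L2_dot (u i - u j) (u i - u j))%:E)%E.
  rewrite -integral_L2_sqr; apply: ae_eq_integral => //.
  - by apply/measurable_EFinP/measurable_funX/measurable_funB.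
  - exact/measurable_EFinP/measurable_funX.
  - by have := L2_subE (u i) (u j); apply: filterS => x /(_ I) -> _.
pose w j x : \bar R := (4 ^+ j * (u j.+1 x - u j x) ^+ 2)%:E.
pose G x := (\sum_(j <oo) w j x)%E.
have w0 j x : (0 <= w j x)%E.
  by rewrite lee_fin mulr_ge0 ?sqr_ge0 ?exprn_ge0.
have mw j : measurable_fun setT (w j).
  by apply/measurable_EFinP/measurable_funM => //;
    apply: measurable_funX; exact: measurable_funB.
have mG : measurable_fun setT G by exact: ge0_emeasurable_sum.
have G0 x : (0 <= G x)%E by exact: nneseries_ge0.
have intG : (\int[mu]_x G x <= 2%:E)%E.
  rewrite integral_nneseries//.
  apply: le_trans (epsilon_trick0 xpredT (ler0n R 2)).
  apply: lee_nneseries => [j _ _|j _]; first exact: integral_ge0.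
  rewrite /w; under eq_integral do rewrite EFinM.
  rewrite ge0_integralZl_EFin//; last 2 first.
  - by move=> x _; rewrite lee_fin sqr_ge0.
  - by apply/measurable_EFinP/measurable_funX/measurable_funB.
  rewrite int_uB -EFinM lee_fin.
  apply: (@le_trans _ _ (4 ^+ j * (8 ^+ j)^-1)).
    by apply: ler_wpM2l; [exact: exprn_ge0|exact: u_cauchy].
  rewrite natrX exprS (_ : 8 = 4 * 2 :> R) ?exprMn; last by rewrite -natrM.
  rewrite !invfM !mulrA !divff ?expf_neq0 ?pnatr_eq0//.
(* Truncating u to D makes it converge everywhere without changing its classes. *)
pose D := [set x | (G x < +oo)%E].
have mD : measurable D by rewrite -[D]setTI; exact: emeasurable_fun_infty_o.
have aeD : {ae mu, forall x, D x}.
  have /(integrable_ae measurableT) : mu.-integrable setT G.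
    apply/integrableP; split => //.
    under eq_integral do rewrite gee0_abs//.
    exact: le_lt_trans intG (ltry _).
  by apply: filterS => x /(_ I) Gx; rewrite /D/= ltey_eq Gx.
pose v j := (u j : T -> R) \_ D.
have mv j : measurable_fun setT (v j).
  exact/(measurable_restrictT _ mD)/measurable_funTS.
have v_cvg x : cvgn (v ^~ x).
  have [Dx|Dx] := pselect (D x); last first.
    rewrite (_ : v ^~ x = cst 0); first exact: is_cvg_cst.
    by apply/funext => j; rewrite /v patchE memNset.
  rewrite (_ : v ^~ x = u ^~ x); last first.
    by apply/funext => j; rewrite /v patchE mem_set.
  have u_cvg : cvgn (series (telescope (u ^~ x))).
    apply: normed_cvg.
    pose M := fine (G x) + 1.
    apply: (@series_le_cvg _ _ (geometric M 2^-1)) => //.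
    - by move=> j; exact: normr_ge0.
    - by move=> j; rewrite /geometric/= mulr_ge0 ?exprn_ge0// addr_ge0// fine_ge0.
    - move=> j; rewrite /geometric/= /telescope.
      rewrite exprVn ler_pdivlMr ?exprn_gt0//.
      have : 4 ^+ j * (u j.+1 x - u j x) ^+ 2 <= fine (G x).
        rewrite -lee_fin fineK ?ge0_fin_numE//.
        have := @nneseries_lim_ge R (w ^~ x) xpredT 0 j.+1 (fun n _ _ => w0 n x).
        apply: le_trans; rewrite big_nat_recr//=.
        by rewrite leeDr// sume_ge0.
      rewrite (_ : 4 = 2 ^+ 2 :> R); last by rewrite -natrX.
      rewrite -exprM mulnC exprM -exprMn -[_ ^+ 2]real_normK ?num_real//.
      rewrite normrM (ger0_norm (exprn_ge0 _ _))// /M mulrC => h.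
      have G0' : 0 <= fine (G x) by rewrite fine_ge0.
      nra.
    - by apply: is_cvg_geometric_series; rewrite ger0_norm ?invf_lt1 ?ltr1n.
  have /(_ _ _) := is_cvgD u_cvg (is_cvg_cst (u 0 x)).
  rewrite telescopeK (_ : _ + _ = u ^~ x); first exact.
  by apply/funext => j; exact: subrK.
pose f0 x := limn (v ^~ x).
have mf0 : measurable_fun setT f0 by exact: (measurable_fun_cvg mv).
have f0_close j : (\int[mu]_x ((f0 x - u j x) ^+ 2)%:E <= ((8 ^+ j)^-1)%:E)%E.
  rewrite (eq_integral
    (fun x => limn_einf (fun i => ((v i x - u j x) ^+ 2)%:E))); last first.
    move=> x _; apply/esym.
    have /cvg_limn_einf_sup[//] : ((v i x - u j x) ^+ 2)%:E @[i --> \oo] -->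
        ((f0 x - u j x) ^+ 2)%:E.
    apply: cvg_EFin; first exact: nearW.
    have vu_cvg : v i x - u j x @[i --> \oo] --> f0 x - u j x.
      by apply: cvgB; [exact: v_cvg|exact: cvg_cst].
    exact: (cvgM vu_cvg vu_cvg).
  apply: le_trans.
    apply: fatou => // [i|i x _]; last by rewrite lee_fin sqr_ge0.
    by apply/measurable_EFinP/measurable_funX/measurable_funB.
  rewrite limn_einf_lim; apply: lime_le; first exact: is_cvg_einfs.
  apply: nearW => n.
  apply: (@le_trans _ _ (\int[mu]_x ((v (maxn n j) x - u j x) ^+ 2)%:E)%E).
    by apply: ereal_inf_lbound; exists (maxn n j) => //=; exact: leq_maxl.
  rewrite (_ : integral _ _ _ =
      (\int[mu]_x ((u (maxn n j) x - u j x) ^+ 2)%:E)%E).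
    by rewrite int_uB lee_fin u_cauchy// leq_maxr.
  apply: ae_eq_integral => //.
  - by apply/measurable_EFinP/measurable_funX/measurable_funB.
  - by apply/measurable_EFinP/measurable_funX/measurable_funB.
  - by apply: filterS aeD => x Dx _; rewrite /v patchE mem_set.
have Lf0 : f0 \in Lfun mu 2%:E.
  rewrite (_ : f0 = (f0 \- u 0) \+ u 0); last first.
    by apply/funext => x /=; rewrite subrK.
  have [_] := Lfun_addr_closed mu (lee1n 2); apply; last exact: L2_Lfun.
  apply: Lfun2P; first exact: measurable_funB.
  exact: le_lt_trans (f0_close 0%N) (ltry _).
exists (L2_class Lf0) => j; rewrite -lee_fin -integral_L2_sqr.
apply: le_trans (f0_close j); rewrite le_eqVlt; apply/orP; left; apply/eqP.
apply: ae_eq_integral => //.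
- exact/measurable_EFinP/measurable_funX.
- by apply/measurable_EFinP/measurable_funX/measurable_funB.
- have := L2_classE Lf0; apply: filter_app.
  have := L2_subE (L2_class Lf0) (u j); apply: filterS.
  move=> x /(_ I) E /(_ I) E' _; congr (_ ^+ 2)%:E.
  by rewrite [LHS]E; congr (_ - _); exact: E'.
Qed.

End L2_hilbert.

Section riesz_fischer.
Context d (T : measurableType d) (R : realType) (mu : {measure set T -> \bar R}).
Variable e : nat -> L2 mu.
Hypothesis e_orth : forall i j, L2_dot (e i) (e j) = (i == j)%:R.

Let L2_dot_basis_sqr (f : L2 mu) k : L2_dot f (e k) ^+ 2 <= L2_dot f f.
Proof.
apply: le_trans (L2_bessel e_orth f k.+1).
by rewrite big_ord_recr/= lerDr sumr_ge0// => i _; exact: sqr_ge0.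
Qed.

(** The partial sums of the series with coefficients a, taken along indices m j
    beyond which the tails of the series of squares are at most 8^-j, converge
    fast. *)
Lemma riesz_fischer (a : nat -> R) (c : R) :
  (forall n, \sum_(i < n) a i ^+ 2 <= c) ->
  exists f, forall k, L2_dot f (e k) = a k.
Proof.
move=> ac; pose A n := \sum_(i < n) a i ^+ 2.
have ndA : nondecreasing_seq A.
  apply/nondecreasing_seqP => n.
  by rewrite /A big_ord_recr/= lerDl sqr_ge0.
have ubA : has_ubound (range A) by exists c => _ [n _ <-]; exact: ac.
have A_cvg := nondecreasing_cvgn ndA ubA.
have A_sup n : A n <= sup (range A) by apply: ub_le_sup => //; exists n.
have /choice[N AN] j : exists n, sup (range A) - A n <= (8 ^+ j)^-1.
  have e0 : 0 < (8 ^+ j)^-1 :> R by rewrite invr_gt0 exprn_gt0.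
  have /cvgrPdist_le/(_ _ e0)[n _ /(_ n (leqnn n))] := A_cvg.
  by rewrite /= ger0_norm ?subr_ge0//; exists n.
(* The terms i.+1 make m j larger than any k <= j, so that the k-th coordinate
   of u j is a k. *)
pose m j := (\max_(i < j.+1) maxn i.+1 (N i))%N.
have m_ge j i : (i <= j)%N -> (maxn i.+1 (N i) <= m j)%N.
  rewrite -ltnS => ij.
  exact: (@leq_bigmax _ (fun k : 'I__ => maxn k.+1 (N k)) (Ordinal ij)).
have m_le i j : (i <= j)%N -> (m i <= m j)%N.
  move=> ij; apply/bigmax_leqP => k _; apply: m_ge.
  by apply: leq_trans ij; rewrite -ltnS.
pose u j := \sum_(i < m j) a i *: e i.
have u_cauchy i j : (j <= i)%N -> L2_dot (u i - u j) (u i - u j) <= (8 ^+ j)^-1.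
  move=> ji; rewrite /u (L2_dot_partialB e_orth)//; last exact: m_le.
  apply: le_trans (AN j); apply: lerB; first exact: A_sup.
  by apply: ndA; apply: leq_trans (m_ge j j (leqnn j)); exact: leq_maxr.
have [f fu] := L2_complete_fast u_cauchy.
exists f => k; apply/eqP; rewrite -subr_eq0 -sqrf_eq0 eq_le sqr_ge0 andbT.
have dk j : (k <= j)%N -> (L2_dot f (e k) - a k) ^+ 2 <= 2^-1 ^+ j.
  move=> kj; apply: (@le_trans _ _ (8 ^+ j)^-1).
    have -> : a k = L2_dot (u j) (e k).
      rewrite (L2_dot_partial_basis e_orth) ifT//.
      by apply: leq_trans (m_ge j k kj); rewrite leq_maxl.
    rewrite -L2_dotBl; apply: le_trans (fu j); exact: L2_dot_basis_sqr.
  by rewrite exprVn lef_pV2 ?posrE ?exprn_gt0// lerXn2r ?nnegrE// ler_nat.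
have half0 : (2^-1 : R) ^+ j @[j --> \oo] --> (0 : R).
  by apply: cvg_expr; rewrite ger0_norm ?invf_lt1 ?ltr1n.
apply: (cvgr_to_ge half0).
by exists k => // j /= /dk.
Qed.

End riesz_fischer.

(** * Operators that agree on orthonormal bases *)

Section bounded_op_basis.
Context (R : realType).

Lemma bounded_op_dot d d' (T : measurableType d) (T' : measurableType d')
    (mu : {measure set T -> \bar R}) (nu : {measure set T' -> \bar R})
    (U : L2 mu -> L2 nu) : bounded_op U ->
  exists C : R, 0 <= C /\ forall f, L2_dot (U f) (U f) <= C * L2_dot f f.
Proof.
move=> [C UC]; exists (C ^+ 2); split=> [|f]; first exact: sqr_ge0.
rewrite -!L2_norm_sqr -exprMn lerXn2r ?nnegrE ?L2_norm_ge0//.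
exact: le_trans (L2_norm_ge0 _) (UC f).
Qed.

Lemma bounded_op_comp d1 d2 d3 (T1 : measurableType d1) (T2 : measurableType d2)
    (T3 : measurableType d3) (mu1 : {measure set T1 -> \bar R})
    (mu2 : {measure set T2 -> \bar R}) (mu3 : {measure set T3 -> \bar R})
    (A : L2 mu2 -> L2 mu3) (U : L2 mu1 -> L2 mu2) :
  bounded_op A -> bounded_op U -> bounded_op (A \o U).
Proof.
move=> [C2 AC] [C1 UC]; exists (`|C2| * C1) => f /=.
apply: le_trans (AC _) _; rewrite -mulrA.
apply: le_trans (ler_wpM2r (L2_norm_ge0 _) (ler_norm _)) _.
by rewrite ler_wpM2l.
Qed.

Lemma orthonormal_basis_inj d (T : measurableType d)
    (mu : {measure set T -> \bar R}) (e : nat -> L2 mu) (f : L2 mu) :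
  orthonormal_basis e -> (forall k, L2_dot f (e k) = 0) -> f = 0.
Proof.
move=> [_ /(_ f) fe] f0; apply: L2_norm_eq0.
apply: cvg_unique fe => //.
rewrite (_ : (fun N : nat => _) = cst (L2_norm f)); first exact: cvg_cst.
by apply/funext => N /=; rewrite big1 ?subr0// => i _; rewrite f0 scale0r.
Qed.

Section transfer.
Context d1 d2 (T1 : measurableType d1) (T2 : measurableType d2).
Context (mu1 : {measure set T1 -> \bar R}) (mu2 : {measure set T2 -> \bar R}).
Variables (e1 : nat -> L2 mu1) (e2 : nat -> L2 mu2).
Hypotheses (e1P : orthonormal_basis e1) (e2P : orthonormal_basis e2).

Lemma same_coordinates (x1 : L2 mu1) :
  exists x2 : L2 mu2, forall k, L2_dot x1 (e1 k) = L2_dot x2 (e2 k).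
Proof.
have [f fx] := @riesz_fischer _ _ _ _ _ e2P.1 (fun k => L2_dot x1 (e1 k)) _
  (L2_bessel e1P.1 x1).
by exists f => k; rewrite fx.
Qed.

(** A and B agree on corresponding partial sums, which converge to x1 and x2,
    and boundedness passes this to the limit. *)
Lemma bounded_op_same_coordinates d (T : measurableType d)
    (nu : {measure set T -> \bar R})
    (A : {linear L2 mu1 -> L2 nu}) (B : {linear L2 mu2 -> L2 nu}) x1 x2 :
  bounded_op A -> bounded_op B -> (forall k, A (e1 k) = B (e2 k)) ->
  (forall k, L2_dot x1 (e1 k) = L2_dot x2 (e2 k)) -> A x1 = B x2.
Proof.
move=> /bounded_op_dot[C1 [C10 AC]] /bounded_op_dot[C2 [C20 BC]] AB x12.
pose S1 N := \sum_(i < N) L2_dot x1 (e1 i) *: e1 i.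
pose S2 N := \sum_(i < N) L2_dot x2 (e2 i) *: e2 i.
have AS N : A (S1 N) = B (S2 N).
  by rewrite !linear_sum; apply: eq_bigr => i _; rewrite !linearZ/= AB x12.
apply/eqP; rewrite -subr_eq0; apply/eqP/L2_dot_eq0/eqP.
rewrite eq_le L2_dot_ge0 andbT.
pose r N := 2 * (C1 * L2_norm (x1 - S1 N) ^+ 2) +
            2 * (C2 * L2_norm (x2 - S2 N) ^+ 2).
have r0 : r N @[N --> \oo] --> 2 * (C1 * (0 * 0)) + 2 * (C2 * (0 * 0)).
  have n1 := e1P.2 x1; have n2 := e2P.2 x2.
  apply: cvgD; (apply: cvgM; first exact: cvg_cst);
    (apply: cvgM; first exact: cvg_cst).
    exact: (cvgM n1 n1).
  exact: (cvgM n2 n2).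
rewrite !mulr0 addr0 in r0.
apply: (cvgr_to_ge r0); apply: nearW => N.
rewrite (_ : A x1 - B x2 = A (x1 - S1 N) + B (S2 N - x2)); last first.
  by rewrite !linearB/= AS addrA subrK.
apply: le_trans (L2_sqrD_le _ _) _; rewrite /r !L2_norm_sqr.
apply: lerD; rewrite ler_pM2l ?ltr0n//.
apply: le_trans (BC _) _; rewrite -(opprB x2) -scaleN1r.
by rewrite L2_dotZl L2_dotC L2_dotZl mulrA mulrNN !mul1r.
Qed.

End transfer.

(** Both bijections identify an L2 space with the space of square-summable
    sequences, and A becomes the identity of that space. *)
Lemma bijective_same_basis d1 d2 d3 d4 (T1 : measurableType d1)
    (T2 : measurableType d2) (T3 : measurableType d3) (T4 : measurableType d4)
    (mu1 : {measure set T1 -> \bar R}) (mu2 : {measure set T2 -> \bar R})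
    (mu3 : {measure set T3 -> \bar R}) (mu4 : {measure set T4 -> \bar R})
    (e1 : nat -> L2 mu1) (e2 : nat -> L2 mu2)
    (U : {linear L2 mu1 -> L2 mu3}) (V : {linear L2 mu2 -> L2 mu4})
    (A : {linear L2 mu3 -> L2 mu4}) :
  orthonormal_basis e1 -> orthonormal_basis e2 ->
  bounded_op U -> bounded_op V -> bounded_op A ->
  bijective U -> bijective V -> (forall k, A (U (e1 k)) = V (e2 k)) ->
  injective A /\ forall y, exists x, A x = y.
Proof.
move=> e1P e2P bU bV bA [U' UK U'K] [V' VK V'K] AUV.
have bAU : bounded_op (A \o U) by exact: bounded_op_comp.
split=> [|y].
  apply: raddf_inj => f Af0.
  have [x2 x12] := same_coordinates e1P e2P (U' f).
  have := bounded_op_same_coordinates e1P e2P bAU bV AUV x12.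
  rewrite /= U'K Af0 => /(congr1 V'); rewrite VK => x20.
  have V0 : V' 0 = 0 by rewrite -(linear0 V) VK.
  rewrite -(U'K f) (@orthonormal_basis_inj _ _ _ _ (U' f) e1P) ?linear0// => k.
  by rewrite x12 -x20 V0 L2_dot0l.
have [x1 x12] := same_coordinates e2P e1P (V' y).
exists (U x1); rewrite -[RHS]V'K.
by apply: (bounded_op_same_coordinates e1P e2P bAU bV AUV).
Qed.

End bounded_op_basis.

(** * Weights and comparison of measures *)

Section measure_facts.
Context d (T : measurableType d) (R : realType).

(** With sets F i of finite measure that cover T, take the sum of their
    indicators with coefficients at most 2^-(i+1) / (1 + mu (F i)). Multiplying
    by such a weight brings bounded functions into L2 without changing where they
    vanish. *)
Lemma sigma_finite_weight (mu : {measure set T -> \bar R}) :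
  sigma_finite setT mu -> exists w : T -> R,
    [/\ measurable_fun setT w, forall x, 0 < w x <= 1 &
        (\int[mu]_x (w x)%:E < +oo)%E].
Proof.
move=> [F UF mF].
pose c i : R := (fine (mu (F i)) + 1)^-1 * (1 / (2 ^ i.+1)%:R).
have p0 i : 0 < (1 / (2 ^ i.+1)%:R) :> R by rewrite divr_gt0 ?ltr0n ?expn_gt0.
have m0 i : 0 < fine (mu (F i)) + 1 by rewrite ltr_wpDl// fine_ge0.
have c0 i : 0 < c i by rewrite mulr_gt0// invr_gt0.
pose t i x : \bar R := (c i * \1_(F i) x)%:E.
have t0 i x : (0 <= t i x)%E by rewrite lee_fin mulr_ge0// ltW.
have mt i : measurable_fun setT (t i).
  apply/measurable_EFinP/measurable_funM => //.
  by apply: measurable_indic; exact: (mF i).1.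
pose s x := (\sum_(i <oo) t i x)%E.
have ms : measurable_fun setT s by exact: ge0_emeasurable_sum.
have s1 x : (s x <= 1)%E.
  apply: le_trans (epsilon_trick0 xpredT (@ler01 R)).
  apply: lee_nneseries => // i _; rewrite lee_fin.
  apply: (@le_trans _ _ (c i * 1)).
    by rewrite ler_pM2l// indicE lern1 leq_b1.
  rewrite mulr1 /c; apply: ler_piMl; first exact: ltW.
  by rewrite invf_le1// lerDr fine_ge0.
have s0 x : (0 < s x)%E.
  have [i _ Fix] : (\bigcup_i F i) x by rewrite -UF.
  apply: (@lt_le_trans _ _ (t i x)).
    by rewrite lte_fin indicE mem_set// mulr1.
  apply: le_trans (nneseries_lim_ge i.+1 _) => //.
  by rewrite big_nat_recr//= leeDr// sume_ge0.
have sfin x : s x \is a fin_num.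
  by rewrite ge0_fin_numE ?(ltW (s0 x))// (le_lt_trans (s1 x))// ltry.
exists (fun x => fine (s x)); split => [|x|].
- exact: measurableT_comp.
- by rewrite -lte_fin -(lee_fin _ 1) fineK// s0 s1.
under eq_integral do rewrite fineK//.
rewrite integral_nneseries//.
apply: (@le_lt_trans _ _ 1%:E); last exact: ltry.
apply: le_trans (epsilon_trick0 xpredT (@ler01 R)).
apply: lee_nneseries => [i _ _|i _]; first exact: integral_ge0.
rewrite /t; under eq_integral do rewrite EFinM.
rewrite ge0_integralZl_EFin//; last 2 first.
- by apply/measurable_EFinP/measurable_indic; exact: (mF i).1.
- exact: ltW.
rewrite integral_indic// ?setIT; last exact: (mF i).1.
have mu_fin : mu (F i) \is a fin_num by rewrite ge0_fin_numE// (mF i).2.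
rewrite -(fineK mu_fin) -EFinM lee_fin /c mulrAC.
apply: ler_piMl; first exact: ltW.
by rewrite mulrC ler_pdivrMr// mul1r lerDl.
Qed.

Lemma le_measure_integral_on (mu nu : {measure set T -> \bar R}) (D : set T)
    (c : R) (f : T -> \bar R) : measurable D -> 0 <= c ->
  (forall B, measurable B -> B `<=` D -> (mu B <= c%:E * nu B)%E) ->
  (forall x, 0 <= f x)%E -> measurable_fun setT f ->
  (\int[mu]_(x in D) f x <= c%:E * \int[nu]_(x in D) f x)%E.
Proof.
move=> mD c0 munu f0 mf.
rewrite (@eq_measure_integral _ _ _ D (mrestr mu mD)); last first.
  by move=> A mA AD; rewrite /= /mrestr setIidl.
rewrite -(ge0_integral_mscale nu mD (NngNum c0))//; last exact: measurable_funTS.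
apply: ge0_le_measure_integral => // S mS.
rewrite /= /mrestr /mscale/=; apply: (@le_trans _ _ (c%:E * nu (S `&` D))%E).
  by apply: munu => //; exact: measurableI.
apply: lee_wpmul2l; first by rewrite lee_fin.
by apply: le_measure => //; rewrite inE//; exact: measurableI.
Qed.

End measure_facts.

(** * Composition with a measurable map on L2 *)

Lemma Lfun2_le_weight d (T : measurableType d) (R : realType)
    (mu : {measure set T -> \bar R}) (w f : T -> R) :
  measurable_fun setT w -> measurable_fun setT f ->
  (\int[mu]_x (w x)%:E < +oo)%E -> (forall x, f x ^+ 2 <= w x) ->
  f \in Lfun mu 2%:E.
Proof.
move=> mw mf woo fw; apply: Lfun2P => //; apply: le_lt_trans woo.
apply: ge0_le_integral => //.
- by move=> x _; rewrite lee_fin sqr_ge0.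
- by apply/measurable_EFinP/measurable_funX.
- exact/measurable_EFinP.
- by move=> x _; rewrite lee_fin.
Qed.

Section composition_L2.
Context d1 d2 (X1 : measurableType d1) (X2 : measurableType d2) (R : realType).
Variables (mu1 : {measure set X1 -> \bar R}) (mu2 : {measure set X2 -> \bar R}).
Variable phi : X2 -> X1.
Hypothesis mphi : measurable_fun setT phi.

(** Stated for functions instead of classes, so that it applies to explicit
    functions and sets; comp_injectiveP returns to classes. *)
Definition comp_injective := forall f, f \in Lfun mu1 2%:E ->
  {ae mu2, forall x, f (phi x) = 0} -> {ae mu1, forall x, f x = 0}.

Definition comp_surjective := forall psi, psi \in Lfun mu2 2%:E ->
  exists2 f, f \in Lfun mu1 2%:E & {ae mu2, forall x, f (phi x) = psi x}.

Let measurable_phi B : measurable B -> measurable (phi @^-1` B).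
Proof. by move=> mB; rewrite -[X in measurable X]setTI; exact: mphi. Qed.

(** Apply injectivity to the indicator of B times a weight. *)
Lemma comp_injective_null B : sigma_finite setT mu1 -> comp_injective ->
  measurable B -> mu2 (phi @^-1` B) = 0%E -> mu1 B = 0%E.
Proof.
move=> /sigma_finite_weight[w [mw w01 woo]] cinj mB B0.
have w0 x : 0 < w x by have /andP[] := w01 x.
have w1 x : w x <= 1 by have /andP[] := w01 x.
pose f x := w x * \1_B x.
have Lf : f \in Lfun mu1 2%:E.
  apply: (Lfun2_le_weight mw _ woo).
    by apply: measurable_funM => //; exact: measurable_indic.
  move=> x; rewrite /f indicE; case: (x \in B); last by rewrite mulr0 expr0n ltW.
  by rewrite mulr1 expr2 ler_piMl// ltW.
have [|N [mN N0 fN]] := cinj f Lf.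
  exists (phi @^-1` B); split => [||x /= fx]; [exact: measurable_phi|by []|].
  by apply: contrapT => Bx; apply: fx; rewrite /f indicE memNset ?mulr0.
apply/(subset_measure0 mB mN _ N0) => x Bx; apply: fN => /= /eqP.
by rewrite /f indicE mem_set// mulr1 gt_eqF.
Qed.

(** If no F k is null, let u be the sum of the functions
    t k = 2^k w 1_{F k} / p k, where w is a weight and p k its integral over F k.
    The integral of t k is 2^k, so that of u is infinite; but the integral of
    (t k) o phi is at most 2^-k, so that of u o phi is finite. Then the composite
    of s = sqrt u with phi is in L2, hence equals f o phi with f in L2, and s = f
    almost everywhere since phi detects null sets: the integral of u would be
    finite. *)
Lemma comp_bijective_lower_bound (F : nat -> set X1) :
  sigma_finite setT mu1 -> comp_injective -> comp_surjective ->
  (forall k, measurable (F k)) ->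
  (forall k B, measurable B -> B `<=` F k ->
     mu2 (phi @^-1` B) <= ((4 ^+ k)^-1)%:E * mu1 B)%E ->
  exists k, mu1 (F k) = 0%E.
Proof.
move=> sf1 cinj csurj mF Fle; apply: contrapT => /forallNP F0.
have [w [mw w01 woo]] := sigma_finite_weight sf1.
have w0 x : 0 < w x by have /andP[] := w01 x.
have mwE : measurable_fun setT (EFin \o w) by exact/measurable_EFinP.
pose p k := (\int[mu1]_(x in F k) (w x)%:E)%E.
have p_lty k : (p k < +oo)%E.
  apply: le_lt_trans woo; apply: ge0_subset_integral => //.
  by move=> x _; rewrite lee_fin ltW.
have p_gt0 k : (0 < p k)%E.
  rewrite lt_neqAle integral_ge0 ?andbT; last by move=> x _; rewrite lee_fin ltW.
  apply/eqP => pk0; apply: (F0 k).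
  have : (\int[mu1]_(x in F k) `|(w x)%:E| = 0)%E.
    rewrite [RHS]pk0; apply: eq_integral => x _.
    by rewrite gee0_abs// lee_fin ltW.
  move/(ae_eq_integral_abs _ (mF k) (measurable_funTS mwE)) => -[N [mN N0 wN]].
  apply: (subset_measure0 (mF k) mN _ N0) => x Fx; apply: wN => /= /(_ Fx) [].
  by apply/eqP; rewrite gt_eqF.
have pE k : (fine (p k))%:E = p k by rewrite fineK// gt0_fin_numE.
have fp_gt0 k : 0 < fine (p k) by rewrite -lte_fin pE.
pose t k x : \bar R := ((2 ^+ k / fine (p k)) * (w x * \1_(F k) x))%:E.
have c_gt0 k : 0 < 2 ^+ k / fine (p k) by rewrite divr_gt0 ?exprn_gt0.
have t0 k x : (0 <= t k x)%E.
  by rewrite lee_fin mulr_ge0 ?(ltW (c_gt0 k))// mulr_ge0// ltW.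
have mt k : measurable_fun setT (t k).
  by apply/measurable_EFinP/measurable_funM => //; apply: measurable_funM.
pose u x := (\sum_(k <oo) t k x)%E.
have u0 x : (0 <= u x)%E by exact: nneseries_ge0.
have m_u : measurable_fun setT u by exact: ge0_emeasurable_sum.
have tF (nu : {measure set X1 -> \bar R}) k :
    (\int[nu]_x t k x = \int[nu]_(x in F k) t k x)%E.
  rewrite [RHS]integral_mkcond; apply: eq_integral => x _.
  rewrite patchE; case: ifPn => // xF.
  by rewrite /t indicE (negbTE xF) !mulr0.
have int_t k : (\int[mu1]_x t k x = (2 ^+ k)%:E)%E.
  rewrite tF.
  rewrite (eq_integral
    (fun x => (2 ^+ k / fine (p k))%:E * (w x)%:E)%E); last first.
    by move=> x xF; rewrite /t indicE xF mulr1 EFinM.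
  rewrite ge0_integralZl_EFin//; last 3 first.
  - by move=> x _; rewrite lee_fin ltW.
  - exact: measurable_funTS.
  - exact: ltW.
  transitivity ((2 ^+ k / fine (p k))%:E * (fine (p k))%:E)%E.
    by rewrite pE.
  by rewrite -EFinM divfK// gt_eqF.
have int_u_phi : (\int[mu2]_x u (phi x) <= 2%:E)%E.
  rewrite integral_nneseries//; last first.
    by move=> k; exact: measurableT_comp (mt k) mphi.
  apply: le_trans (epsilon_trick0 xpredT (ler0n R 2)).
  apply: lee_nneseries => [k _ _|k _]; first exact: integral_ge0.
  rewrite -(ge0_integral_pushforward mphi mu2 measurableT (mt k))// tF.
  apply: le_trans.
    apply: (@le_measure_integral_on _ _ _ _ mu1 _ (4 ^+ k)^-1) => //.
    by move=> B; exact: Fle.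
  rewrite -tF int_t -EFinM lee_fin natrX exprS.
  rewrite (_ : 4 = 2 * 2 :> R) ?exprMn; last by rewrite -natrM.
  rewrite !invfM !mulrA divff ?pnatr_eq0// mul1r mulrAC.
  by rewrite mulVf ?mul1r ?expf_neq0 ?pnatr_eq0.
(* u may take the value +oo, where fine makes s vanish; u_fin below shows that
   these points form a null set. *)
pose s x := (fine (u x)) `^ 2^-1.
have ms : measurable_fun setT s.
  by apply: (measurableT_comp (measurable_powR _)); exact: measurableT_comp.
have ssqr x : s x ^+ 2 = fine (u x).
  by rewrite /s powR12_sqrt ?sqr_sqrtr ?fine_ge0.
have Ls : s \o phi \in Lfun mu2 2%:E.
  apply: Lfun2P; first exact: measurableT_comp.
  apply: le_lt_trans (ltry 2); apply: le_trans int_u_phi.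
  apply: ge0_le_integral => //.
  - by move=> x _; rewrite lee_fin sqr_ge0.
  - apply/measurable_EFinP/measurable_funX; exact: measurableT_comp.
  - exact: measurableT_comp.
  - move=> x _; rewrite /= ssqr; case: (u (phi x)) (u0 (phi x)) => [r _|_|//].
      exact: lexx.
    exact: leey.
have [f Lf fs] := csurj _ Ls.
have mf : measurable_fun setT f by apply/set_mem; exact: sub_Lfun_mfun Lf.
have fsE : {ae mu1, forall x, f x = s x}.
  pose B := [set x | f x != s x].
  have mB : measurable B.
    rewrite -[B]setTI; apply: (measurable_neg (measurable_fun_eqr mf ms)) => //.
  have B0 : mu2 (phi @^-1` B) = 0%E.
    apply/(negligibleP _ (measurable_phi mB)); move: fs => [N [mN N0 fN]].
    by exists N; split => // x; rewrite /B /= => /eqP Bx; apply: fN.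
  exists B; split => //; first exact: comp_injective_null B0.
  by move=> x /= /eqP.
have u_fin : {ae mu1, forall x, u x \is a fin_num}.
  pose B := [set x | u x \isn't a fin_num].
  have mB : measurable B.
    rewrite (_ : B = ~` [set x | u x \is a fin_num]).
      apply: measurableC; rewrite -[X in measurable X]setTI.
      exact: emeasurable_fin_num.
    by apply/seteqP; split => x /= /negP.
  have B0 : mu2 (phi @^-1` B) = 0%E.
    apply/(negligibleP _ (measurable_phi mB)).
    have /(integrable_ae measurableT) : mu2.-integrable setT (u \o phi).
      apply/integrableP; split; first exact: (measurableT_comp m_u mphi).
      rewrite (eq_integral (u \o phi)); last first.
        by move=> x _; rewrite gee0_abs// u0.
      exact: le_lt_trans int_u_phi (ltry _).
    by apply: negligibleS => x /= /negP Bx /(_ I).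
  exists B; split => //; first exact: comp_injective_null B0.
  by move=> x /= /negP.
have int_u : (\int[mu1]_x u x < +oo)%E.
  have /integrableP[_] := Lfun2_integrable_sqr Lf.
  apply: le_lt_trans; rewrite le_eqVlt; apply/orP; left; apply/eqP.
  apply: ge0_ae_eq_integral => //.
  - by apply: measurableT_comp => //; apply/measurable_EFinP/measurable_funX.
  - apply: filter_app u_fin; apply: filterS fsE => x fsx ux _ /=.
    by rewrite fsx ger0_norm ?sqr_ge0// ssqr fineK.
have int_u_ge k : ((2 ^+ k)%:E <= \int[mu1]_x u x)%E.
  rewrite -int_t; apply: ge0_le_integral => // x _.
  apply: le_trans (nneseries_lim_ge k.+1 _) => //.
  by rewrite big_nat_recr//= leeDr// sume_ge0.
have iu0 : (0 <= \int[mu1]_x u x)%E by exact: integral_ge0.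
have [k] : exists k, fine (\int[mu1]_x u x)%E < 2 ^+ k.
  exists (Num.bound (fine (\int[mu1]_x u x)%E)).
  apply: (@lt_le_trans _ _ (Num.bound (fine (\int[mu1]_x u x)%E))%:R).
    by apply: archi_boundP; exact: fine_ge0.
  by rewrite -natrX ler_nat ltnW// ltn_expl.
rewrite -lte_fin fineK ?ge0_fin_numE// => /lt_le_trans/(_ (int_u_ge k)).
by rewrite ltxx.
Qed.

(** The auxiliary square-integrable functions v = w / (1 + rho^2) and rho * v
    are composites with phi by surjectivity, and rho is their quotient. *)
Lemma comp_surjective_factor (rho : X2 -> R) :
  sigma_finite setT mu2 -> comp_surjective -> measurable_fun setT rho ->
  exists2 q : X1 -> R, measurable_fun setT q &
    {ae mu2, forall x, q (phi x) = rho x}.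
Proof.
move=> /sigma_finite_weight[w [mw w01 woo]] csurj mrho.
have w0 x : 0 < w x by have /andP[] := w01 x.
have w1 x : w x <= 1 by have /andP[] := w01 x.
(* Writing the inverse as a power reduces its measurability to that of powers. *)
pose v x := w x * (1 + rho x ^+ 2) `^ (-1).
have d_ge1 x : 1 <= 1 + rho x ^+ 2 by rewrite lerDl sqr_ge0.
have d_gt0 x : 0 < 1 + rho x ^+ 2 by apply: lt_le_trans (d_ge1 x).
have vE x : v x = w x / (1 + rho x ^+ 2) by rewrite /v powR_inv1// ltW.
have v0 x : 0 < v x by rewrite vE divr_gt0.
have mv : measurable_fun setT v.
  apply: measurable_funM => //; apply: (measurableT_comp (measurable_powR _)).
  by apply: measurable_funD => //; exact: measurable_funX.
have Lv : v \in Lfun mu2 2%:E.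
  apply: (Lfun2_le_weight mw mv woo) => x.
  have vw : v x <= w x by rewrite vE ler_pdivrMr// ler_peMr// ltW.
  have := v0 x; have := w1 x; nra.
have Lrv : (fun x => rho x * v x) \in Lfun mu2 2%:E.
  apply: (Lfun2_le_weight mw _ woo); first exact: measurable_funM.
  move=> x; have : v x * (1 + rho x ^+ 2) = w x by rewrite vE divfK// gt_eqF.
  have := v0 x; have := w1 x; have := sqr_ge0 (rho x).
  rewrite exprMn; set r2 := rho x ^+ 2 => r20 ww vv ve.
  nra.
have [f0 Lf0 f0E] := csurj _ Lv.
have [f1 Lf1 f1E] := csurj _ Lrv.
exists (fun y => f1 y * (f0 y) `^ (-1)).
  apply: measurable_funM; first by apply/set_mem; exact: sub_Lfun_mfun Lf1.
  apply: (measurableT_comp (measurable_powR _)).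
  by apply/set_mem; exact: sub_Lfun_mfun Lf0.
apply: filter_app f0E; apply: filterS f1E => x -> ->.
by rewrite powR_inv1 ?(ltW (v0 x))// mulfK// gt_eqF.
Qed.

Section dominated_measure.
Variable C : R.
Hypothesis C0 : 0 <= C.
Hypothesis dom : forall B, measurable B ->
  (mu1 B <= C%:E * mu2 (phi @^-1` B))%E.

Lemma dominated_comp_injective : comp_injective.
Proof.
move=> f Lf f0; pose B := [set x | f x != 0].
have mB : measurable B.
  rewrite -[B]setTI; apply: (measurable_neg (measurable_fun_eqr _ _)) => //.
  by apply/set_mem; exact: sub_Lfun_mfun Lf.
have B0 : mu2 (phi @^-1` B) = 0%E.
  apply/(negligibleP _ (measurable_phi mB)); move: f0 => [N [mN N0 fN]].
  by exists N; split => // x; rewrite /B /= => /eqP Bx; apply: fN.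
exists B; split => //; last by move=> x /= /eqP.
by apply/eqP; rewrite -measure_le0 (le_trans (dom mB))// B0 mule0.
Qed.

(** The preimage of psi is psi o k; domination bounds its norm by that of psi. *)
Lemma dominated_comp_surjective (k : X1 -> X2) : measurable_fun setT k ->
  {ae mu2, forall x, k (phi x) = x} -> comp_surjective.
Proof.
move=> mk kphi psi Lpsi.
have mpsi : measurable_fun setT psi by apply/set_mem; exact: sub_Lfun_mfun Lpsi.
have mf : measurable_fun setT (psi \o k) by exact: measurableT_comp.
have mf2 : measurable_fun setT (fun y => ((psi \o k) y ^+ 2)%:E).
  exact/measurable_EFinP/measurable_funX.
have fphi : {ae mu2, forall x, (psi \o k) (phi x) = psi x}.
  by apply: filterS kphi => x /= ->.
exists (psi \o k) => //; apply: Lfun2P => //.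
apply: (@le_lt_trans _ _ (C%:E * \int[mu2]_x (psi x ^+ 2)%:E)%E); last first.
  apply: lte_mul_pinfty => //.
  exact: integrable_lty (Lfun2_integrable_sqr Lpsi).
apply: le_trans.
  apply: (@le_measure_integral_on _ _ _ _ (pushforward mu2 phi) setT C) => //.
  - by move=> B mB _; exact: dom.
  - by move=> y; rewrite lee_fin sqr_ge0.
rewrite ge0_integral_pushforward//; last by move=> y _; rewrite lee_fin sqr_ge0.
rewrite preimage_setT le_eqVlt; apply/orP; left; apply/eqP; congr (_ * _)%E.
apply: ae_eq_integral => //.
- exact: (measurableT_comp mf2 mphi).
- exact/measurable_EFinP/measurable_funX.
- by apply: filterS fphi => x /= ->.
Qed.

End dominated_measure.

End composition_L2.

Section L2_operator.
Context d1 d2 (X1 : measurableType d1) (X2 : measurableType d2) (R : realType).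
Variables (mu1 : {measure set X1 -> \bar R}) (mu2 : {measure set X2 -> \bar R}).
Variables (phi : X2 -> X1) (A : {linear L2 mu1 -> L2 mu2}).
Hypothesis AE : forall (f : L2 mu1) (f' : X1 -> R), f = f' %[ae mu1] ->
  {ae mu2, forall x, A f x = f' (phi x)}.

Lemma comp_injectiveP : injective A <-> comp_injective mu1 mu2 phi.
Proof.
split=> [injA f Lf f0|cinj].
  have A0 : A (L2_class Lf) = 0.
    have Lf0 : (cst 0 : X1 -> R) \in Lfun mu1 2%:E.
      by have [] := Lfun_addr_closed mu1 (lee1n 2).
    apply: L2P; rewrite -(linear0 A).
    have z0 : (0 : L2 mu1) = (cst 0 : X1 -> R) %[ae mu1] by exact: L2_classE.
    have := AE z0; apply: filter_app.
    have := AE (L2_classE Lf); apply: filter_app.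
    by apply: filterS f0 => x fx0 -> -> _.
  have : L2_class Lf = 0 by apply: injA; rewrite A0 linear0.
  move=> f00; have := L2_classE Lf; rewrite f00; apply: filter_app.
  have z0 : (0 : L2 mu1) = (cst 0 : X1 -> R) %[ae mu1] by exact: L2_classE.
  by apply: filterS z0 => x /(_ I) E /(_ I) <-.
apply: raddf_inj => f Af0; apply: L2P.
have z1 : (0 : L2 mu1) = (cst 0 : X1 -> R) %[ae mu1] by exact: L2_classE.
have z2 : (0 : L2 mu2) = (cst 0 : X2 -> R) %[ae mu2] by exact: L2_classE.
have : {ae mu1, forall x, f x = 0}.
  apply: cinj; first exact: L2_Lfun.
  have := AE (ae_eq_refl mu1 setT f); apply: filter_app.
  by rewrite Af0; apply: filterS z2 => x /(_ I) E <-.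
by apply: filter_app; apply: filterS z1 => x /(_ I) E -> _; rewrite E.
Qed.

Lemma comp_surjectiveP :
  (forall psi, exists f, A f = psi) <-> comp_surjective mu1 mu2 phi.
Proof.
split=> [surjA psi Lpsi|csurj psi].
  have [f Af] := surjA (L2_class Lpsi).
  exists f; first exact: L2_Lfun.
  have := AE (ae_eq_refl mu1 setT f); apply: filter_app.
  by rewrite Af; have := L2_classE Lpsi; apply: filterS => x /(_ I) E <-.
have [f Lf fpsi] := csurj _ (L2_Lfun psi).
exists (L2_class Lf); apply: L2P.
have := AE (L2_classE Lf); apply: filter_app.
by apply: filterS fpsi => x <- ->.
Qed.

End L2_operator.

(** * The composition operator between open sets *)

Section lebesgue_on_facts.
Context (R : realType) (n : nat) (O : set 'rV[R]_n) (oO : open O).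

Lemma ae_lebesgue_onP (P : 'rV[R]_n -> Prop) :
  {ae lebesgue_on oO, forall x, P x} <->
  {ae lebesgue_rV n, forall x, O x -> P x}.
Proof.
have mO : measurable O by exact: open_measurable_mx.
split=> -[N [mN N0 PN]].
  exists (N `&` O); split => //; first exact: measurableI.
  by move=> x /= /not_implyP[Ox Px]; split => //; exact: PN.
exists (N `|` ~` O); split.
- by apply: measurableU => //; exact: measurableC.
- rewrite /lebesgue_on/= /mrestr setIUl setICl setU0.
  apply: subset_measure0 N0 => //; exact: measurableI.
- move=> x /= Px; have [Ox|Ox] := pselect (O x); last by right.
  by left; apply: PN => /= /(_ Ox).
Qed.

Lemma sigma_finite_lebesgue_on : sigma_finite setT (lebesgue_on oO).
Proof.
have mO : measurable O by exact: open_measurable_mx.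
have [F UF mF] := sigma_finiteT (@lebesgue_rV R n).
exists F => // i; have [mFi Fi] := mF i; split => //.
rewrite /lebesgue_on/= /mrestr; apply: le_lt_trans Fi.
by apply: le_measure => //; rewrite inE//; exact: measurableI.
Qed.

End lebesgue_on_facts.

Section comp_op.
Context (R : realType) (n : nat) (O1 O2 : set 'rV[R]_n).
Context (oO1 : open O1) (oO2 : open O2).
Variables (h : {fun O2 >-> O1}) (mh : measurable_fun O2 h).
Hypothesis ns : nonsingular h.
Hypothesis h_comp : composition_operator oO1 oO2 mh.

Local Notation mu1 := (lebesgue_on oO1).
Local Notation mu2 := (lebesgue_on oO2).
Let mO1 : measurable O1 := open_measurable_mx oO1.
Let mO2 : measurable O2 := open_measurable_mx oO2.

(** A map that is measurable on the whole space, as push-forward measures and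
    integral formulas for them require. *)
Definition ext_map : 'rV[R]_n -> 'rV[R]_n := h \_ O2.

Lemma measurable_ext_map : measurable_fun setT ext_map.
Proof. by apply/(measurable_restrictT _ mO2). Qed.

Lemma ext_mapE x : O2 x -> ext_map x = h x.
Proof. by move=> Ox; rewrite /ext_map patchE mem_set. Qed.

Lemma ae_ext_map : {ae mu2, forall x, ext_map x = h x}.
Proof. by apply/ae_lebesgue_onP/aeW => x; exact: ext_mapE. Qed.

Lemma lebesgue_on_preimage B :
  mu2 (ext_map @^-1` B) = pushforward_on h (B `&` O1).
Proof.
rewrite /lebesgue_on/= /mrestr /pushforward_on; congr (lebesgue_rV n _).
apply/seteqP; split => x /= [].
  move=> Bx Ox; move: Bx; rewrite ext_mapE// => Bhx.
  by split => //; split => //; exact: funS.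
by move=> Ox [Bx _]; rewrite ext_mapE.
Qed.

Let comp_op_Lfun (f : L2 mu1) : (comp_op oO2 mh f : _ -> R) \in Lfun mu2 2%:E.
Proof.
rewrite inE; apply/andP; split; rewrite inE; first exact: measurable_L0.
have [C /(_ f) hC] := h_comp.
rewrite /= /finite_norm; apply: le_lt_trans hC _.
by rewrite -L2_normE -EFinM ltry.
Qed.

Let T (f : L2 mu1) : L2 mu2 := L2_class (comp_op_Lfun f).

Let TE f : L0_of_L2 (T f) = comp_op oO2 mh f.
Proof. by apply: L0P; exact: L2_classE. Qed.

Let T_ae (f : L2 mu1) (f' : 'rV[R]_n -> R) : f = f' %[ae mu1] ->
  {ae mu2, forall x, T f x = f' (ext_map x)}.
Proof.
move=> ff'; have := comp_opE oO2 mh ns ff'; apply: filter_app.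
have := L2_classE (comp_op_Lfun f); apply: filter_app.
apply: filterS ae_ext_map => x -> /(_ I) Tx /(_ I) cx.
by rewrite [LHS]Tx; exact: cx.
Qed.

Let T_linear : linear T.
Proof.
move=> a f g; apply: L2P.
have E : (a *: f + g : L2 mu1) = (fun x => a * f x + g x) %[ae mu1].
  have := L2_scaleE a f; apply: filter_app.
  have := L2_addE (a *: f) g; apply: filterS.
  by move=> x /(_ I) -> /(_ I) E _; congr (_ + _); exact: E.
have := T_ae E; apply: filter_app.
have := T_ae (ae_eq_refl mu1 setT f); apply: filter_app.
have := T_ae (ae_eq_refl mu1 setT g); apply: filter_app.
have := L2_scaleE a (T f); apply: filter_app.
have := L2_addE (a *: T f) (T g); apply: filterS.
move=> x /(_ I) E1 /(_ I) E2 E3 E4 E5 _; rewrite E5 E1 -E3 -E4.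
by congr (_ + _); rewrite E2.
Qed.

(** The values of C_h are a priori only classes of measurable functions; this
    is C_h with values in the Hilbert space. *)
Lemma comp_op_linearE : exists A : {linear L2 mu1 -> L2 mu2},
  [/\ bounded_op A, forall f, L0_of_L2 (A f) = comp_op oO2 mh f &
      forall (f : L2 mu1) (f' : 'rV[R]_n -> R), f = f' %[ae mu1] ->
        {ae mu2, forall x, A f x = f' (ext_map x)}].
Proof.
pose A : {linear L2 mu1 -> L2 mu2} :=
  HB.pack T (GRing.isLinear.Build R (L2 mu1) (L2 mu2) *:%R T T_linear).
exists A; split => //.
have [C hC] := h_comp; exists C => f.
rewrite -lee_fin EFinM !L2_normE; apply: le_trans (hC f).
by rewrite -TE.
Qed.

End comp_op.

(** * Injectivity of h and the lower bound of its density *)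

Section euclidean.
Context (R : realType) (n : nat) (O1 O2 : set 'rV[R]_n).
Context (oO1 : open O1) (oO2 : open O2).
Variables (h : {fun O2 >-> O1}) (mh : measurable_fun O2 h).

Local Notation mu1 := (lebesgue_on oO1).
Local Notation mu2 := (lebesgue_on oO2).
Let mO1 : measurable O1 := open_measurable_mx oO1.
Let mO2 : measurable O2 := open_measurable_mx oO2.

(** The coordinate functions factor through h; their factors are the components
    of a left inverse k, which h1 corrects to take its values in O2. *)
Lemma comp_surjective_ae_injective : O2 !=set0 ->
  comp_surjective mu1 mu2 (ext_map h) -> ae_injective h.
Proof.
move=> [p O2p] csurj.
have qP j : exists q : 'rV[R]_n -> R, measurable_fun setT q /\
    {ae mu2, forall x, q (ext_map h x) = x ord0 j}.
  have [|q mq qE] := comp_surjective_factor (sigma_finite_lebesgue_on oO2)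
    csurj (rho := fun x : 'rV[R]_n => x ord0 j).
    exact: measurable_coord.
  by exists q.
have [q qE] := choice qP.
pose k y : 'rV[R]_n := \row_j q j y.
have mk : measurable_fun setT k.
  apply: measurable_fun_mx => i j; under eq_fun do rewrite mxE.
  exact: (qE j).1.
have kE : {ae mu2, forall x, k (ext_map h x) = x}.
  have : {ae mu2, forall x, forall j, q j (ext_map h x) = x ord0 j}.
    by apply: filter_forall => j; exact: (qE j).2.
  by apply: filterS => x qx; apply/rowP => j; rewrite mxE qx.
pose h1 y := if k y \in O2 then k y else p.
have h1O : {homo h1 : x / O1 x >-> O2 x}.
  by move=> y _; rewrite /h1; case: ifPn => //; rewrite inE.
exists (mkfun h1O); split.
  apply: measurable_funTS; apply: measurable_fun_ifT => //.
  apply: (measurable_fun_bool true); rewrite setTI.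
  rewrite (_ : _ @^-1` _ = k @^-1` O2); last first.
    by apply/seteqP; split => y ky; [exact: set_mem|exact: mem_set].
  by rewrite -[X in measurable X]setTI; exact: mk.
apply: (ae_lebesgue_onP oO2 _).1; apply: filter_app kE.
apply/ae_lebesgue_onP/aeW => x O2x kx.
move: kx; rewrite (ext_mapE h O2x) => kx.
by transitivity (h1 (h x)) => //; rewrite /h1 kx mem_set.
Qed.

Lemma ae_injective_left_inverse : ae_injective h ->
  exists2 k, measurable_fun setT k & {ae mu2, forall x, k (ext_map h x) = x}.
Proof.
move=> [h1 [mh1 h1h]]; exists (h1 \_ O1).
  exact/(measurable_restrictT _ mO1).
apply/ae_lebesgue_onP; apply: filterS h1h => x hx O2x.
by rewrite ext_mapE// patchE mem_set ?hx//; exact: funS.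
Qed.

Variable g : 'rV[R]_n -> \bar R.
Hypothesis gP : is_radon_nikodym h g.

Lemma comp_bijective_radon_nikodym_ge :
  comp_injective mu1 mu2 (ext_map h) -> comp_surjective mu1 mu2 (ext_map h) ->
  exists r : R, 0 < r /\ {ae lebesgue_rV n, forall x, O1 x -> (r%:E <= g x)%E}.
Proof.
move=> cinj csurj; have [mg g0 gE] := gP.
pose F k := O1 `&` [set x | (g x < ((4 ^+ k)^-1)%:E)%E].
have mF k : measurable (F k) by exact: emeasurable_fun_infty_o.
have [k Fk0] : exists k, mu1 (F k) = 0%E.
  apply: (comp_bijective_lower_bound (measurable_ext_map oO2 mh)
    (sigma_finite_lebesgue_on oO1) cinj csurj mF) => k B mB BF.
  rewrite lebesgue_on_preimage.
  have BO : B `<=` O1 by move=> x /BF [].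
  rewrite (setIidl BO) gE// /lebesgue_on/= /mrestr (setIidl BO).
  have : (\int[lebesgue_rV n]_(x in B) g x <=
          \int[lebesgue_rV n]_(x in B) ((4 ^+ k)^-1)%:E)%E.
    apply: ge0_le_integral => //.
    - by move=> x /BO; exact: g0.
    - exact: measurable_funS mg.
    - by move=> x /BF[_ /ltW].
  by rewrite integral_cst.
exists (4 ^+ k)^-1; split; first by rewrite invr_gt0 exprn_gt0.
exists (F k); split => //.
  by move: Fk0; rewrite /lebesgue_on/= /mrestr setIidl// => x [].
by move=> x /= /not_implyP[Ox /negP]; rewrite -ltNge => gx; split.
Qed.

Lemma radon_nikodym_ge_dominated (r : R) : 0 < r ->
  {ae lebesgue_rV n, forall x, O1 x -> (r%:E <= g x)%E} ->
  forall B, measurable B -> (mu1 B <= r^-1%:E * mu2 (ext_map h @^-1` B))%E.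
Proof.
move=> r0 gr B mB; have [mg g0 gE] := gP.
have mBO : measurable (B `&` O1) by exact: measurableI.
rewrite lebesgue_on_preimage gE//.
rewrite muleC lee_pdivlMr// muleC {1}/lebesgue_on/= /mrestr -integral_cst//.
apply: ae_ge0_le_integral => //.
- by move=> x _; rewrite lee_fin ltW.
- by move=> x [_ /g0].
- exact: measurable_funS mg.
- by apply: filterS gr => x gx [_ /gx].
Qed.

End euclidean.

Theorem theorem3p1 (R : realType) (n : nat)
    (Omega1 Omega2 : set 'rV[R]_n) (oO1 : open Omega1) (oO2 : open Omega2)
    (gamma : nat -> L2 (lebesgue_on oO1))
    (gamma_riesz : riesz_basis (fun k => L0_of_L2 (gamma k)))
    (h : {fun Omega2 >-> Omega1}) (mh : measurable_fun Omega2 h)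
    (h_nonsingular : nonsingular h)
    (h_comp : composition_operator oO1 oO2 mh)
    (g_h : 'rV[R]_n -> \bar R) (g_hP : is_radon_nikodym h g_h) :
  riesz_basis (fun k => comp_op oO2 mh (gamma k)) <->
  (ae_injective h /\
   exists r : R, 0 < r /\
     \forall x \ae (lebesgue_rV n : set 'rV[R]_n -> \bar R),
       Omega1 x -> (r%:E <= g_h x)%E).
Proof.
have [A [bA AE A_ae]] := comp_op_linearE h_nonsingular h_comp.
have [Oe [oOe [e [U [eP bU U_bij gammaE]]]]] := gamma_riesz.
have gammaU k : gamma k = U (e k) by exact: L0_of_L2_inj.
split=> [[Oe2 [oOe2 [e2 [V [e2P bV V_bij VE]]]]]|[h_inj [r [r0 gr]]]].
  have AUV k : A (U (e k)) = V (e2 k).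
    by apply: L0_of_L2_inj; rewrite AE -gammaU.
  have [A_inj A_surj] := bijective_same_basis eP e2P bU bV bA U_bij V_bij AUV.
  have cinj := (comp_injectiveP A_ae).1 A_inj.
  have csurj := (comp_surjectiveP A_ae).1 A_surj.
  split; last exact: (comp_bijective_radon_nikodym_ge mh g_hP cinj csurj).
  (* A left inverse with values in Omega2 requires Omega2 to be nonempty; if it
     were empty, V would send a unit vector to 0. *)
  apply: comp_surjective_ae_injective csurj.
  apply/set0P/eqP => /seteqP[sub0 _].
  have V0 : V (e2 0%N) = 0.
    by apply: L2P; apply/ae_lebesgue_onP/aeW => x /sub0.
  have e20 : e2 0%N = 0 by apply: (bij_inj V_bij); rewrite V0 linear0.
  have := e2P.1 0%N 0%N.
  by rewrite e20 L2_dot0l eqxx => /esym/eqP; rewrite oner_eq0.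
have dom := radon_nikodym_ge_dominated oO1 oO2 g_hP r0 gr.
have ri0 : 0 <= r^-1 by rewrite invr_ge0 ltW.
have mext := measurable_ext_map oO2 mh.
have A_inj : injective A.
  exact: ((comp_injectiveP A_ae).2 (dominated_comp_injective mext dom)).
have [k mk kE] := ae_injective_left_inverse oO1 oO2 h_inj.
have A_surj : forall psi, exists f, A f = psi.
  apply: (comp_surjectiveP A_ae).2.
  exact: (dominated_comp_surjective mext ri0 dom mk kE).
have [A' AA'] := choice A_surj.
have A_bij : bijective A.
  by exists A' => // f; apply: A_inj; rewrite AA'.
exists Oe, oOe, e, (A \o U : {linear _ -> _}); split => //.
- exact: bounded_op_comp.
- exact: bij_comp.
- by move=> j; rewrite /= AE gammaU.
Qed.
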